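(* Let $n\ge 1$ and let $\mathcal A$ be a subalgebra of $M_n$ with $\mathcal D_n\subseteq\mathcal A\subseteq M_n$. If $\mathcal A$ is a logmodular subalgebra of $M_n$, then every contractive representation of $\mathcal A$ (on any Hilbert space) is completely contractive.
   Context: $M_n$ denotes the C*-algebra of $n\times n$ complex matrices and $\mathcal D_n\subseteq M_n$ the subalgebra of diagonal matrices. For a unital C*-algebra $\mathcal B$ and a unital subalgebra $\mathcal A\subseteq\mathcal B$, $\mathcal A^{-1}$ denotes the set of elements of $\mathcal A$ that are invertible with inverse in $\mathcal A$, and $\mathcal B_+^{-1}$ denotes the set of positive invertible elements of $\mathcal B$. $\mathcal A$ is called logmodular in $\mathcal B$ if $\{a^*a : a\in\mathcal A^{-1}\}$ is (norm) dense in $\mathcal B_+^{-1}$. A (contractive) representation of $\mathcal A$ on a Hilbert space $\mathcal H$ is a unital contractive homomorphism $\rho:\mathcal A\to B(\mathcal H)$. It is completely contractive if for every $k$ the map $(a_{i,j})\mapsto(\rho(a_{i,j}))$ from $M_k(\mathcal A)\subseteq M_k(\mathcal B)$ to $M_k(B(\mathcal H))=B(\mathcal H^{(k)})$ is contractive, where here $\mathcal B=M_n$. *)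

(* Defs.v *)
From HB Require Import structures.
From mathcomp Require Import all_boot all_order all_algebra.
From mathcomp Require Import sesquilinear spectral complex.
From mathcomp Require Import all_classical all_reals all_analysis.

Set Implicit Arguments.
Unset Strict Implicit.
Unset Printing Implicit Defensive.

Import Order.TTheory GRing.Theory Num.Theory.
Import numFieldNormedType.Exports.
Local Open Scope classical_set_scope.
Local Open Scope ring_scope.
Local Open Scope sesquilinear_scope.

(* The complex numbers are R[i] for R : realType. Their library norm takes its
   values in R[i] (on the real axis); norms below are taken back to R with
   complex.Re, so that suprema make sense. *)

(* The inner product is linear in its first argument. *)
HB.mixin Record CompleteNormedModule_isHilbert (R : realType) H
    & CompleteNormedModule R[i] H := {
  inner : {dot H for (@Num.conj R[i])} ;
  inner_norm : forall x : H, inner x x = `|x| ^+ 2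
}.

#[short(type="hilbertType")]
HB.structure Definition Hilbert (R : realType) :=
  {H of CompleteNormedModule R[i] H & CompleteNormedModule_isHilbert R H}.

Definition hnorm (R : realType) (H : hilbertType R) (x : H) : R :=
  complex.Re `|x|.

(* The l2-direct-sum norm on V^k, N being the norm of V. *)
Definition l2norm (R : realType) (V : Type) (N : V -> R) (k : nat)
    (x : {ffun 'I_k -> V}) : R :=
  Num.sqrt (\sum_(i < k) N (x i) ^+ 2).

(* [sup] returns 0 on unbounded sets: this is meant for bounded operators. *)
Definition opnorm (R : realType) (V : Type) (N : V -> R) (f : V -> V) : R :=
  sup [set N (f x) | x in [set x | N x <= 1]].

(* An element of M_k(B(V)) as an operator on V^k. *)
Definition block_op (V : nmodType) (k : nat) (T : 'I_k -> 'I_k -> V -> V)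
    (x : {ffun 'I_k -> V}) : {ffun 'I_k -> V} :=
  [ffun i => \sum_(j < k) T i j (x j)].

(* B(H). *)
Record bounded_op (R : realType) (H : hilbertType R) := BoundedOp {
  op_fun :> H -> H ;
  op_linear : linear op_fun ;
  op_bounded : exists M : R, forall x, hnorm (op_fun x) <= M * hnorm x
}.

Section MatrixAlgebra.
Variables (R : realType) (n : nat).
Local Notation C := R[i].
Implicit Types (A : {pred 'M[C]_n}) (a b : 'M[C]_n).

Definition euclid_norm (x : 'cV[C]_n) : R :=
  Num.sqrt (\sum_(i < n) complex.Re `|x i 0| ^+ 2).

(* The C*-norms of M_n = B(C^n) and M_k(M_n) = B((C^n)^k). The library norm on
   matrices, which is the maximum of the norms of the entries, is not used. *)
Definition mx_opnorm a : R := opnorm euclid_norm (mulmx a).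

Definition block_mx_opnorm (k : nat) (a : 'M['M[C]_n]_k) : R :=
  opnorm (@l2norm R _ euclid_norm k) (block_op (fun i j => mulmx (a i j))).

(* Unitality is not asked for: it follows from containing the diagonal
   matrices. *)
Definition is_subalgebra A : Prop :=
  submod_closed A /\ forall a b, a \in A -> b \in A -> a *m b \in A.

Definition units_in A : set 'M[C]_n :=
  [set a | [/\ a \in A, a \in unitmx & invmx a \in A]].

Definition positive_mx b : Prop :=
  b \is hermsymmx /\ forall z : C, eigenvalue b z -> 0 <= z.

(* Only approximation is required: a^* a with a invertible is always positive
   and invertible. *)
Definition logmodular A : Prop :=
  forall b, positive_mx b -> b \in unitmx ->
  forall e : R, 0 < e ->
  exists2 a, a \in units_in A & mx_opnorm (b - a ^t* *m a) < e.

(* A representation of A is carried by a function on all of M_n of which only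
   the values on A matter. *)
Record contractive_rep A (H : hilbertType R) (rho : 'M[C]_n -> bounded_op H) :
    Prop := ContractiveRep {
  rep_linear : forall (c : C) a b, a \in A -> b \in A ->
    forall x, rho (c *: a + b) x = c *: rho a x + rho b x ;
  rep_mul : forall a b, a \in A -> b \in A ->
    forall x, rho (a *m b) x = rho a (rho b x) ;
  rep_one : forall x, rho 1%:M x = x ;
  rep_contractive : forall a, a \in A ->
    opnorm (@hnorm R H) (rho a) <= mx_opnorm a
}.

Definition completely_contractive A (H : hilbertType R)
    (rho : 'M[C]_n -> bounded_op H) : Prop :=
  forall (k : nat) (a : 'M['M[C]_n]_k), (forall i j, a i j \in A) ->
  opnorm (@l2norm R H (@hnorm R H) k) (block_op (fun i j => rho (a i j)))
    <= block_mx_opnorm a.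

End MatrixAlgebra.

(* Main.v *)
Require Import Defs.
From mathcomp Require Import all_boot all_order all_algebra.
From mathcomp Require Import perm sesquilinear spectral ring.
From mathcomp Require Import complex all_classical all_reals all_analysis.

(** Write p <= q when the matrix unit E_pq lies in A. As A contains the diagonal
    matrices, E_pp a E_qq = a_pq E_pq shows that A is spanned by the matrix
    units it contains, so that <= is a preorder which determines A.

    Logmodularity makes this preorder total [logmodular_total]. If i and j are
    incomparable and a is a unit of A, the part of column j of a which lives on
    the rows k <= i is a combination of the columns of a of index below both i
    and j. Hence an entry (i, j) of the Gram matrix of a is determined by other
    entries of it, and the positive matrix b = c^t* c with c = 1 + E_ij violates
    this relation by so much that it is at distance at least 1 from all these
    Gram matrices.

    A contractive representation rho sends the units E_pq of A to contractions
    K_pq with K_pq K_qr = K_pr; moreover K_qp is the adjoint of K_pq when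
    p <= q <= p, because symmetries of A are sent to contractive involutions,
    which are self-adjoint [rep_delta_adjoint]. As the preorder is total, the
    operators K_pq and their adjoints fill a Hermitian operator matrix. It is
    positive [rep_form_ge0]: after sorting the indices increasingly, its
    quadratic form at u equals

      |s_1|^2 + sum_p (|s_(p+1)|^2 - |K_(p,p+1) s_(p+1)|^2),
      s_p = sum_(q >= p) K_pq u_q.

    Therefore E_pq |-> K_pq extends rho to a Schur product map on all of M_n
    which is completely positive and unital, hence completely contractive.
    No dilation space has to be built for the last step: the positive form on
    H^n given by the operator matrix replaces it. A matrix of scalars of norm m
    acts with norm at most m on tuples of vectors of any space with a positive
    semidefinite form [form_ampliation], and the block operator of rho at a is
    a compression of the action of the scalar matrix a for this form
    [rep_completely_contractive]. *)

Set Implicit Arguments.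
Unset Strict Implicit.
Unset Printing Implicit Defensive.

Import Order.TTheory GRing.Theory Num.Theory.
Local Open Scope ring_scope.
Local Open Scope sesquilinear_scope.

(** * Operator norms *)

Section OperatorNorm.
Variables (R : realType) (V : lmodType R[i]) (N : V -> R).
Hypothesis N_ge0 : forall x, 0 <= N x.
Hypothesis NZ : forall (c : R) x, 0 <= c -> N ((c%:C)%C *: x) = c * N x.

Lemma opnorm_le (f : V -> V) (m : R) :
  (forall x, N x <= 1 -> N (f x) <= m) -> opnorm N f <= m.
Proof.
move=> fm; apply: ge_sup => [|_ [x /= Nx <-]]; last exact: fm.
exists (N (f 0)), 0 => //=.
by rewrite -(scaler0 _ (0%:C)%C) NZ // mul0r ler01.
Qed.

(** The supremum defining [opnorm] is only meaningful for bounded [f], whence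
    the last hypothesis, which also takes care of the vectors x of norm 0: these
    cannot be rescaled to the unit sphere. *)
Lemma le_opnorm (f : V -> V) x :
  (forall (c : R) y, f ((c%:C)%C *: y) = (c%:C)%C *: f y) ->
  (exists M, forall y, N (f y) <= M * N y) ->
  N (f x) <= opnorm N f * N x.
Proof.
move=> fZ [M fM].
have ubf : has_ubound [set N (f y) | y in [set y | N y <= 1]]%classic.
  exists `|M| => _ [y /= Ny <-]; apply: le_trans (fM y) _.
  apply: le_trans (ler_norm _) _; rewrite normrM (ger0_norm (N_ge0 y)).
  exact: ler_piMr.
have [Nx0|Nx_neq0] := eqVneq (N x) 0.
  by rewrite Nx0 mulr0 -(mulr0 M) -Nx0.
have Nx_gt0 : 0 < N x by rewrite lt_neqAle eq_sym Nx_neq0 N_ge0.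
rewrite -ler_pdivrMr // mulrC -NZ ?invr_ge0 ?N_ge0 // -fZ.
apply: sup_upper_bound; last first.
  by exists ((N x)^-1 %:C *: x)%C => //=; rewrite NZ ?invr_ge0 // mulVf.
by split => //; exists (N (f ((N x)^-1 %:C *: x)%C));
   exists ((N x)^-1 %:C *: x)%C => //=; rewrite NZ ?invr_ge0 // mulVf.
Qed.

(** In particular when f is unbounded: the supremum is then 0. *)
Lemma opnorm_ge0 (f : V -> V) : 0 <= opnorm N f.
Proof.
rewrite /opnorm; set E := [set _ | _ in _]%classic.
have [supE|supE] := pselect (has_sup E); last by rewrite sup_out.
have [[r Er] ubE] := supE; apply: le_trans (sup_upper_bound supE Er).
by case: Er => x _ <-.
Qed.

End OperatorNorm.

Section SquaredNorms.
Variables (R : realType).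
Local Notation C := R[i].

(** Norms take their values in R, inner products in R[i]: inequalities between
    norms are compared with inequalities between inner products after squaring
    and embedding R in R[i]. *)
Definition sqC (r : R) : C := ((r ^+ 2)%:C)%C.

Lemma Re_norm (z : C) : ((complex.Re `|z|)%:C)%C = `|z|.
Proof. by rewrite RRe_real ?normr_real. Qed.

Lemma Re_norm_sq (V : normedModType C) (x : V) :
  sqC (complex.Re `|x|) = `|x| ^+ 2.
Proof. by rewrite /sqC rmorphXn /= RRe_real // normr_real. Qed.

Lemma sqrt_sum_sq (I : finType) (F : I -> R) :
  Num.sqrt (\sum_i F i ^+ 2) ^+ 2 = \sum_i F i ^+ 2.
Proof. by rewrite sqr_sqrtr // sumr_ge0 // => i _; rewrite sqr_ge0. Qed.

Lemma euclid_norm_sq n (x : 'cV[C]_n) :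
  sqC (euclid_norm x) = \sum_i `|x i 0| ^+ 2.
Proof.
rewrite /sqC sqrt_sum_sq rmorph_sum; apply: eq_bigr => i _.
by rewrite rmorphXn; congr (_ ^+ 2); exact: Re_norm.
Qed.

Lemma l2norm_sq (V : Type) (N : V -> R) k (x : {ffun 'I_k -> V}) :
  sqC (l2norm N x) = \sum_i sqC (N (x i)).
Proof. by rewrite /sqC sqrt_sum_sq rmorph_sum. Qed.

Lemma hnorm_sq (H : hilbertType R) (x : H) :
  sqC (hnorm x) = inner x x.
Proof. by rewrite inner_norm; exact: Re_norm_sq. Qed.

Lemma hnorm_ge0 (H : hilbertType R) (x : H) : 0 <= hnorm x.
Proof. by rewrite -lecR RRe_real ?normr_real //; exact: normr_ge0. Qed.

Lemma euclid_norm_ge0 n (x : 'cV[C]_n) : 0 <= euclid_norm x.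
Proof. exact: sqrtr_ge0. Qed.

Lemma l2norm_ge0 (V : Type) (N : V -> R) k (x : {ffun 'I_k -> V}) :
  0 <= l2norm N x.
Proof. exact: sqrtr_ge0. Qed.

Lemma ge0_ler_sqC (a b : R) : 0 <= a -> 0 <= b ->
  (a <= b) = (sqC a <= sqC b).
Proof. by move=> a0 b0; rewrite lecR ler_sqr. Qed.

Lemma ler_mul_sqC (m a b : R) : 0 <= m -> 0 <= a -> 0 <= b ->
  (a <= m * b) = (sqC a <= sqC m * sqC b).
Proof.
move=> m0 a0 b0; rewrite ge0_ler_sqC ?mulr_ge0 //.
by have -> : sqC (m * b) = sqC m * sqC b by rewrite /sqC exprMn rmorphM.
Qed.

Lemma hnormZ (H : hilbertType R) (c : R) (x : H) :
  0 <= c -> hnorm ((c%:C)%C *: x) = c * hnorm x.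
Proof.
move=> c0; apply: complexI; rewrite rmorphM /= !RRe_real ?normr_real //.
by rewrite normrZ ger0_norm // lecR.
Qed.

Lemma l2normZ (V : lmodType C) (N : V -> R) k (c : R) (x : {ffun 'I_k -> V}) :
  (forall y, N ((c%:C)%C *: y) = c * N y) -> 0 <= c ->
  l2norm N ((c%:C)%C *: x) = c * l2norm N x.
Proof.
move=> NZ c0; rewrite /l2norm -[c in RHS](ger0_norm c0) -sqrtr_sqr.
rewrite -sqrtrM ?sqr_ge0 // mulr_sumr.
by congr Num.sqrt; apply: eq_bigr => i _; rewrite ffunE NZ exprMn.
Qed.

Lemma euclid_normZ n (c : R) (x : 'cV[C]_n) :
  0 <= c -> euclid_norm ((c%:C)%C *: x) = c * euclid_norm x.
Proof.
move=> c0; rewrite /euclid_norm -[c in RHS](ger0_norm c0) -sqrtr_sqr.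
rewrite -sqrtrM ?sqr_ge0 // mulr_sumr; congr Num.sqrt; apply: eq_bigr => i _.
rewrite mxE -exprMn; congr (_ ^+ 2); apply: complexI.
by rewrite rmorphM Re_norm normrM ger0_norm ?lecR.
Qed.

(** This crude bound makes the suprema defining the norms of matrices finite.
    Each coordinate of z is at most the l2-norm of z, hence the choice of M. *)
Lemma sum_sq_bound (I J : finType) (a : I -> J -> C) :
  exists M : R, 0 <= M /\ forall z : J -> C,
    \sum_i `|\sum_j a i j * z j| ^+ 2 <= sqC M * \sum_j `|z j| ^+ 2.
Proof.
pose M2 := \sum_i (\sum_j `|a i j|) ^+ 2.
have M2_ge0 : 0 <= M2.
  by apply: sumr_ge0 => i _; apply: exprn_ge0; apply: sumr_ge0.
exists (complex.Re (sqrtC M2)); split.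
  by rewrite -lecR RRe_real ?ger0_real ?sqrtC_ge0.
move=> z; rewrite /sqC rmorphXn /= RRe_real ?ger0_real ?sqrtC_ge0 //.
rewrite sqrtCK mulr_suml.
apply: ler_sum => i _.
set S := \sum_j _ ^+ 2.
have S_ge0 : 0 <= S by apply: sumr_ge0 => j _; apply: exprn_ge0.
rewrite -[S]sqrtCK -exprMn; apply: lerXn2r; rewrite ?nnegrE //.
  by rewrite mulr_ge0 ?sqrtC_ge0 // sumr_ge0.
apply: le_trans (ler_norm_sum _ _ _) _; rewrite mulr_suml.
apply: ler_sum => j _; rewrite normrM ler_wpM2l //.
rewrite -[leLHS](sqrCK (normr_ge0 (z j))) ler_sqrtC ?nnegrE ?exprn_ge0 //.
by rewrite /S (bigD1 j) //= lerDl sumr_ge0 // => l _; apply: exprn_ge0.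
Qed.

End SquaredNorms.

(** * The C*-norms of matrices in coordinates *)

Section MatrixNorms.
Variables (R : realType).
Local Notation C := R[i].

Lemma le_mx_opnorm n (a : 'M[C]_n) (x : 'cV[C]_n) :
  \sum_i `|(a *m x) i 0| ^+ 2
    <= sqC (mx_opnorm a) * \sum_i `|x i 0| ^+ 2.
Proof.
have ax : euclid_norm (a *m x) <= mx_opnorm a * euclid_norm x.
  apply: le_opnorm => [y|c y|c y|].
  - exact: euclid_norm_ge0.
  - exact: euclid_normZ.
  - by rewrite scalemxAr.
  have [M [M0 aM]] := sum_sq_bound (fun i j => a i j).
  exists M => y; rewrite ler_mul_sqC ?euclid_norm_ge0 // !euclid_norm_sq.
  apply: le_trans (aM _); rewrite le_eqVlt; apply/orP/or_introl/eqP.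
  by apply: eq_bigr => i _; rewrite mxE.
by rewrite -!euclid_norm_sq -ler_mul_sqC ?euclid_norm_ge0 //
  (opnorm_ge0 (@euclid_norm_ge0 R n)).
Qed.

Lemma mx_opnorm_le1 n (a : 'M[C]_n) :
  (forall x : 'cV[C]_n, \sum_i `|(a *m x) i 0| ^+ 2 <= \sum_i `|x i 0| ^+ 2) ->
  mx_opnorm a <= 1.
Proof.
move=> a1; apply: opnorm_le => [c x|x]; first exact: euclid_normZ.
apply: le_trans; rewrite ge0_ler_sqC ?euclid_norm_ge0 // !euclid_norm_sq.
exact: a1.
Qed.

Lemma delta_mulmx n p q (x : 'cV[C]_n) k :
  ((delta_mx p q : 'M[C]_n) *m x) k 0 = (k == p)%:R * x q 0.
Proof.
rewrite mxE (bigD1 q) //= big1 ?addr0 => [|l lq]; rewrite mxE ?eqxx ?andbT //.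
by rewrite (negPf lq) andbF mul0r.
Qed.

Lemma mx_opnorm_delta n p q : mx_opnorm (delta_mx p q : 'M[C]_n) <= 1.
Proof.
apply: mx_opnorm_le1 => x.
rewrite (bigD1 p) //= big1 ?addr0 => [|k kp].
  by rewrite delta_mulmx eqxx mul1r (bigD1 q) //= lerDl sumr_ge0.
by rewrite delta_mulmx (negPf kp) mul0r normr0 expr0n.
Qed.

Lemma le_block_mx_opnorm n k (a : 'M['M[C]_n]_k) (z : 'I_k -> 'I_n -> C) :
  \sum_i \sum_p `|\sum_j \sum_q a i j p q * z j q| ^+ 2
    <= sqC (block_mx_opnorm a) * \sum_j \sum_q `|z j q| ^+ 2.
Proof.
pose N := @l2norm R _ (@euclid_norm R n) k.
pose f := block_op (fun i j => mulmx (a i j) : 'cV[C]_n -> 'cV[C]_n).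
have N_ge0 x : 0 <= N x by exact: l2norm_ge0.
have N_sq x : sqC (N x) = \sum_j \sum_q `|x j q 0| ^+ 2.
  by rewrite /N l2norm_sq; apply: eq_bigr => j _; rewrite euclid_norm_sq.
have fE x i p : f x i p 0 = \sum_j \sum_q a i j p q * x j q 0.
  by rewrite ffunE summxE; apply: eq_bigr => j _; rewrite mxE.
have NZ (c : R) x : 0 <= c -> N ((c%:C)%C *: x) = c * N x.
  by move=> c0; apply: l2normZ => // y; exact: euclid_normZ.
have fN x : N (f x) <= block_mx_opnorm a * N x.
  apply: le_opnorm => // [c u|].
    apply/ffunP => i; rewrite !ffunE scaler_sumr; apply: eq_bigr => j _.
    by rewrite ffunE scalemxAr.
  have [M [M0 aM]] := sum_sq_bound
    (fun (s t : 'I_k * 'I_n) => a s.1 t.1 s.2 t.2).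
  exists M => y; rewrite ler_mul_sqC // !N_sq.
  have := aM (fun s => y s.1 s.2 0); rewrite !pair_big /=.
  apply: le_trans; rewrite le_eqVlt; apply/orP/or_introl/eqP.
  by apply: eq_bigr => -[i p] _ /=; rewrite fE pair_big.
pose x : {ffun 'I_k -> 'cV[C]_n} := [ffun j => \col_q z j q].
have xE j q : x j q 0 = z j q by rewrite ffunE mxE.
have m_ge0 : 0 <= block_mx_opnorm a by exact: opnorm_ge0.
have := fN x; rewrite ler_mul_sqC // !N_sq.
rewrite (_ : \sum_j \sum_q `|x j q 0| ^+ 2 = \sum_j \sum_q `|z j q| ^+ 2).
  apply: le_trans; rewrite le_eqVlt; apply/orP/or_introl/eqP.
  apply: eq_bigr => i _; apply: eq_bigr => p _.
  rewrite fE; congr (`|_| ^+ 2); apply: eq_bigr => j _; apply: eq_bigr => q _.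
  by rewrite xE.
by apply: eq_bigr => j _; apply: eq_bigr => q _; rewrite xE.
Qed.

End MatrixNorms.

(** * Logmodular algebras containing the diagonal matrices *)

Section ColumnInnerProduct.
Variables (C : numClosedFieldType) (n : nat).

Definition coldot (x y : 'cV[C]_n) : C := (x^t* *m y) 0 0.

Lemma coldotE x y : coldot x y = \sum_k (x k 0)^* * y k 0.
Proof. by rewrite /coldot mxE; apply: eq_bigr => k _; rewrite !mxE. Qed.

Lemma coldot_normsq x : coldot x x = \sum_k `|x k 0| ^+ 2.
Proof. by rewrite coldotE; apply: eq_bigr => k _; rewrite normCKC. Qed.

Lemma coldot_ge0 x : 0 <= coldot x x.
Proof. by rewrite coldot_normsq sumr_ge0 // => k _; apply: exprn_ge0. Qed.

Lemma coldotC x y : coldot x y = (coldot y x)^*.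
Proof.
rewrite !coldotE rmorph_sum; apply: eq_bigr => k _.
by rewrite rmorphM /= conjCK mulrC.
Qed.

Lemma coldotBl x x' y : coldot (x - x') y = coldot x y - coldot x' y.
Proof. by rewrite /coldot linearB /= map_mxB mulmxBl !mxE. Qed.

Lemma coldotBr x y y' : coldot x (y - y') = coldot x y - coldot x y'.
Proof. by rewrite /coldot mulmxBr !mxE. Qed.

Lemma coldot_mul (a b : 'M[C]_n) x y :
  coldot (a *m x) (b *m y) = coldot x (a^t* *m b *m y).
Proof. by rewrite /coldot trmx_mul map_mxM !mulmxA. Qed.

End ColumnInnerProduct.

Section GramMatrices.
Variables (R : realType) (n : nat).
Local Notation C := R[i].

(** If v c^t* c = z v, then z |v|^2 = |v c^t*|^2. *)
Lemma positive_gram (c : 'M[C]_n) : positive_mx (c^t* *m c).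
Proof.
split.
  apply/is_hermitianmxP.
  by rewrite expr0 scale1r trmx_mul map_mxM trmxCK.
move=> z /eigenvalueP [v vcc v0].
have : z *: (v *m v^t*) = (v *m c^t*) *m (v *m c^t*)^t*.
  by rewrite trmx_mul map_mxM trmxCK mulmxA scalemxAl -vcc -!mulmxA.
move=> /(congr1 (fun M : 'M[C]_1 => M 0 0)); rewrite mxE.
have normsqE (m : nat) (u : 'rV[C]_m) :
    (u *m u^t*) 0 0 = \sum_k `|u 0 k| ^+ 2.
  by rewrite mxE; apply: eq_bigr => k _; rewrite !mxE normCK.
rewrite !normsqE => zE.
have v_gt0 : 0 < \sum_k `|v 0 k| ^+ 2.
  have sq_ge0 k : true -> 0 <= `|v 0 k| ^+ 2 by move=> _; apply: exprn_ge0.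
  rewrite lt_def sumr_ge0 // andbT; apply: contra v0 => /eqP v0.
  apply/eqP/rowP => k; rewrite mxE; apply/eqP; rewrite -normr_eq0 -sqrf_eq0.
  exact/eqP/(psumr_eq0P sq_ge0 v0).
rewrite -(pmulr_lge0 _ v_gt0) zE.
by apply: sumr_ge0 => k _; apply: exprn_ge0.
Qed.

End GramMatrices.

Section AlgebrasContainingDiagonal.
Variables (R : realType) (n : nat) (A : {pred 'M[R[i]]_n}).
Local Notation C := R[i].
Hypothesis A_subalg : is_subalgebra A.
Hypothesis A_diag : forall d : 'M[C]_n, is_diag_mx d -> d \in A.

Lemma subalg0 : 0 \in A. Proof. by case: A_subalg => -[]. Qed.

Lemma subalgD a b : a \in A -> b \in A -> a + b \in A.
Proof.
by case: A_subalg => -[_ Alin] _ Aa Ab; rewrite -[a]scale1r; apply: Alin.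
Qed.

Lemma subalgZ c a : a \in A -> c *: a \in A.
Proof.
case: A_subalg => -[A0 Alin] _ Aa.
by rewrite -[_ *: _]addr0; apply: Alin.
Qed.

Lemma subalgM a b : a \in A -> b \in A -> a *m b \in A.
Proof. by case: A_subalg => _; apply. Qed.

Lemma subalg_delta_diag p : delta_mx p p \in A.
Proof.
apply: A_diag; apply/is_diag_mxP => i j ij; rewrite mxE.
case: (i =P p) => // ip; case: (j =P p) => // jp.
by rewrite ip jp eqxx in ij.
Qed.

Lemma subalg1 : 1%:M \in A.
Proof. exact/A_diag/scalar_mx_is_diag. Qed.

Lemma delta_mulmx_delta (a : 'M[C]_n) p q :
  delta_mx p p *m a *m delta_mx q q = a p q *: delta_mx p q.
Proof.
rewrite -(mul_delta_mx (0 : 'I_1) p p) -(mul_delta_mx (0 : 'I_1) q q).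
rewrite -!mulmxA (mulmxA (delta_mx 0 p)) (mulmxA (delta_mx 0 p *m a)).
rewrite -rowE -colE [X in _ *m (X *m _)]mx11_scalar !mxE mul_scalar_mx.
by rewrite -scalemxAr mul_delta_mx.
Qed.

(** This is where the diagonal matrices enter, by [delta_mulmx_delta]. *)
Lemma delta_mx_in a p q : a \in A -> a p q != 0 -> delta_mx p q \in A.
Proof.
move=> Aa apq; rewrite -[delta_mx p q](scalerK apq) -delta_mulmx_delta.
by apply/subalgZ/subalgM; rewrite ?subalgM ?subalg_delta_diag.
Qed.

Lemma subalg_sum (I : Type) (r : seq I) (c : I -> C) (F : I -> 'M[C]_n) :
  (forall i, c i != 0 -> F i \in A) -> \sum_(i <- r) c i *: F i \in A.
Proof.
move=> AF; elim/big_rec: _ => [|i a _ Aa]; first exact: subalg0.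
have [->|ci] := eqVneq (c i) 0; first by rewrite scale0r add0r.
by rewrite subalgD ?subalgZ ?AF.
Qed.

Lemma mx_sum_delta_pair (a : 'M[C]_n) :
  a = \sum_(s : 'I_n * 'I_n) a s.1 s.2 *: delta_mx s.1 s.2.
Proof. by rewrite {1}[a]matrix_sum_delta pair_big. Qed.

Lemma mem_subalg (a : 'M[C]_n) :
  (forall p q, a p q != 0 -> delta_mx p q \in A) -> a \in A.
Proof.
by move=> Aa; rewrite (mx_sum_delta_pair a); apply: subalg_sum => s; exact: Aa.
Qed.

Lemma delta_mx_in_trans p q r :
  delta_mx p q \in A -> delta_mx q r \in A -> delta_mx p r \in A.
Proof. by move=> pq qr; rewrite -(mul_delta_mx q); apply: subalgM. Qed.

(** Let i and j be incomparable, b = c^t* c with c = 1 + E_ij, and let a be a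
    unit of A. Cutting column j of a down to the rows k <= i yields a vector a w; as
    the inverse of a is in A, w is supported on the indices below both i and j,
    so that w_i = w_j = 0. The vectors y = e_i - w and d = e_j - w have the same
    norm, a y is orthogonal to a d since their supports are disjoint, and
    <b d, y> = |y|^2. So D = b - a^t* a satisfies <D d, y> = |y|^2 = |d|^2,
    which is incompatible with |D| < 1. *)
Lemma logmodular_total : logmodular A ->
  forall i j, (delta_mx i j \in A) || (delta_mx j i \in A).
Proof.
move=> A_log i j; apply/negPn/negP; rewrite negb_or => /andP [NAij NAji].
have ij : i != j.
  by apply: contraNneq NAij => ->; exact: subalg_delta_diag.
pose c : 'M[C]_n := 1%:M + delta_mx i j.
have c_unit : c \in unitmx.
  suff /mulmx1_unit [] : c *m (1%:M - delta_mx i j) = 1%:M by [].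
  rewrite mulmxDl mul1mx mulmxBr mulmx1 mul_delta_mx_0 1?eq_sym //.
  by rewrite subr0 subrK.
have cE (x : 'cV[C]_n) : c *m x = x + x j 0 *: delta_mx i 0.
  rewrite mulmxDl mul1mx -(mul_delta_mx (0 : 'I_1)) -mulmxA -rowE.
  by rewrite [row j x]mx11_scalar !mxE mul_mx_scalar.
have ct_unit : c^t* \in unitmx by rewrite map_unitmx unitmx_tr.
(* The distance of b to the set of all a^t* a is at least 1. *)
have [|a Aa ba] := A_log _ (positive_gram c) _ 1 ltr01.
  by rewrite unitmx_mul ct_unit.
move: Aa; rewrite inE => -[Aa a_unit AVa].
pose v : 'cV[C]_n := \col_l (if delta_mx l i \in A then a l j else 0).
have [w [aw w_supp]] : exists w : 'cV[C]_n, a *m w = v /\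
    forall k, w k 0 != 0 -> (delta_mx k i \in A) && (delta_mx k j \in A).
  exists (invmx a *m v); split=> [|k]; first by rewrite mulKVmx.
  rewrite mxE => /eqP; apply: contra_notT => Nk; apply: big1 => l _.
  rewrite mxE; case: ifPn => [li|]; last by rewrite mulr0.
  apply/eqP; rewrite mulf_eq0; apply: contraNT Nk; rewrite negb_or.
  case/andP => /(delta_mx_in AVa) kl /(delta_mx_in Aa) lj.
  by rewrite !(delta_mx_in_trans kl).
have wi : w i 0 = 0.
  by apply/eqP; apply: contraNT NAij => /w_supp /andP [].
have wj : w j 0 = 0.
  by apply/eqP; apply: contraNT NAji => /w_supp /andP [].
pose d := delta_mx j 0 - w; pose y := delta_mx i 0 - w.
pose S : C := 1 + \sum_k `|w k 0| ^+ 2.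
have S_gt0 : 0 < S.
  by rewrite ltr_pwDl // sumr_ge0 // => k _; apply: exprn_ge0.
have normsqE l : w l 0 = 0 ->
    coldot (delta_mx l 0 - w) (delta_mx l 0 - w) = S.
  move=> wl; rewrite coldot_normsq (bigD1 l) //= !mxE !eqxx wl subr0 normr1.
  rewrite expr1n /S [in RHS](bigD1 l) //= wl normr0 expr0n add0r.
  congr (_ + _); apply: eq_bigr => k kl.
  by rewrite !mxE (negPf kl) sub0r normrN.
have ybd : coldot y (c^t* *m c *m d) = S.
  rewrite -coldot_mul !cE.
  have -> : y j 0 = 0 by rewrite !mxE wj eq_sym (negPf ij) subr0.
  rewrite scale0r addr0 -(normsqE i wi) !coldotE; apply: eq_bigr => k _.
  rewrite -/y !mxE !eqxx wj subr0 mul1r andbT.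
  case: (k =P j) => [->|_].
    by rewrite eq_sym (negPf ij) wj subr0 conjC0 !mul0r.
  by rewrite sub0r addrC.
have yad : coldot y (a^t* *m a *m d) = 0.
  rewrite -coldot_mul coldotE; apply: big1 => l _.
  rewrite /y /d !mulmxBr aw -!colE !mxE.
  case: ifPn => [_|Nli]; first by rewrite subrr mulr0.
  suff -> : a l i = 0 by rewrite subrr conjC0 mul0r.
  by apply/eqP; apply: contraNT Nli; exact: delta_mx_in.
pose D := c^t* *m c - a^t* *m a.
have yDd : coldot y (D *m d) = S.
  by rewrite mulmxBl coldotBr ybd yad subr0.
have yy : coldot y y = S by exact: normsqE.
have dd : coldot d d = S by exact: normsqE.
have Dd_lt : coldot (D *m d) (D *m d) < S.
  apply: le_lt_trans (_ : sqC (mx_opnorm D) * S < S).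
    by rewrite -dd !coldot_normsq; exact: le_mx_opnorm.
  rewrite -[ltRHS]mul1r ltr_pM2r // ltcR expr_lt1 //.
  exact/opnorm_ge0/euclid_norm_ge0.
clearbody y.
(* |y - D d|^2 = |D d|^2 - S stands in for the Cauchy-Schwarz inequality. *)
have := coldot_ge0 (y - D *m d).
rewrite coldotBl !coldotBr yDd [coldot (D *m d) y]coldotC yDd yy.
rewrite subrr sub0r (CrealP _) ?gtr0_real // opprB subr_ge0.
by rewrite (lt_geF Dd_lt).
Qed.

End AlgebrasContainingDiagonal.

(** * Contractive representations *)

Lemma eq_from_sum_diff (F : numFieldType) (a b c d : F) :
  a + b = c + d -> a - b = c - d -> a = c.
Proof.
move=> sum_eq diff_eq.
have double (x y : F) : (x + y) + (x - y) = 2 * x by ring.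
have two0 : (2 : F) != 0 by rewrite pnatr_eq0.
by apply: (mulfI two0); rewrite -(double a b) sum_eq diff_eq double.
Qed.

Section InnerProductSpace.
Variables (R : realType) (H : hilbertType R).
Local Notation C := R[i].
Implicit Types x y : H.

Lemma innerC x y : inner x y = (inner y x)^*.
Proof. by rewrite hermC expr0 mul1r. Qed.

Lemma inner_ge0 x : 0 <= inner x x.
Proof. by rewrite inner_norm exprn_ge0. Qed.

Lemma isometry_inner (U : H -> H) : linear U ->
  (forall x, inner (U x) (U x) = inner x x) ->
  forall x y, inner (U x) (U y) = inner x y.
Proof.
move=> U_lin U_iso x y.
have Hc (c : C) : c * inner (U x) (U y) + c^* * inner (U y) (U x) =
    c * inner x y + c^* * inner y x.
  have := U_iso (c *: x + y).
  rewrite U_lin !linearDl !linearDr /= !linearZl_LR !linearZr_LR /= !U_iso.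
  rewrite -!addrA => /addrI.
  by rewrite !addrA => /addIr.
have H1 := Hc 1; have Hi := Hc 'i.
rewrite conjCi !mulNr -!mulrBr in Hi; move/(mulfI (neq0Ci _)) in Hi.
rewrite conjC1 !mul1r in H1.
exact: eq_from_sum_diff H1 Hi.
Qed.

(** A contraction whose inverse is itself is isometric, so that
    <U x, y> = <U x, U (U y)> = <x, U y>. This is how adjoints are obtained
    below. *)
Lemma contractive_involution_selfadjoint (U : H -> H) : linear U ->
  (forall x, inner (U x) (U x) <= inner x x) -> (forall x, U (U x) = x) ->
  forall x y, inner (U x) y = inner x (U y).
Proof.
move=> U_lin U_contr UK x y; rewrite -[y in LHS]UK.
apply: isometry_inner => // z; apply/le_anti; rewrite U_contr /=.
by rewrite -[in leLHS](UK z).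
Qed.

End InnerProductSpace.

Section ContractiveRepresentations.
Variables (R : realType) (n : nat) (A : {pred 'M[R[i]]_n}).
Local Notation C := R[i].
Hypothesis A_subalg : is_subalgebra A.
Hypothesis A_diag : forall d : 'M[C]_n, is_diag_mx d -> d \in A.
Variables (H : hilbertType R) (rho : 'M[C]_n -> bounded_op H).
Hypothesis rho_rep : contractive_rep A rho.

Lemma rep_le a x : a \in A -> mx_opnorm a <= 1 ->
  inner (rho a x) (rho a x) <= inner x x.
Proof.
move=> Aa a1; rewrite -!hnorm_sq -ge0_ler_sqC ?hnorm_ge0 //.
have [M rhoM] := op_bounded (rho a).
apply: le_trans (_ : opnorm (@hnorm R H) (rho a) * hnorm x <= _).
  apply: le_opnorm => [y|c y|c y|]; last by exists M.
  - exact: hnorm_ge0.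
  - exact: hnormZ.
  - have rho0 : rho a 0 = 0.
      have := op_linear (rho a) (-1) 0 0.
      by rewrite !scaleN1r !oppr0 addr0 addNr.
    by have := op_linear (rho a) (c%:C)%C y 0; rewrite rho0 !addr0.
rewrite ler_piMl ?hnorm_ge0 //; apply: le_trans a1.
exact: rep_contractive rho_rep _ Aa.
Qed.

Lemma rep_sum (I : Type) (r : seq I) (c : I -> C) (F : I -> 'M[C]_n) x :
  (forall i, c i != 0 -> F i \in A) ->
  rho (\sum_(i <- r) c i *: F i) x = \sum_(i <- r) c i *: rho (F i) x.
Proof.
move=> AF; elim: r => [|i r IH].
  have A1 := subalg1 A_diag.
  have := rep_linear rho_rep (-1) A1 A1 x.
  by rewrite !scaleN1r !addNr !big_nil.
rewrite !big_cons; have [->|ci] := eqVneq (c i) 0.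
  by rewrite !scale0r !add0r.
by rewrite (rep_linear rho_rep) ?IH ?AF //; exact: subalg_sum.
Qed.

Local Notation K p q := (rho (delta_mx p q)).

Lemma rep_expand a x : a \in A -> rho a x = \sum_p \sum_q a p q *: K p q x.
Proof.
move=> Aa; rewrite {1}(mx_sum_delta_pair a) pair_big /=.
by rewrite rep_sum // => s; exact: delta_mx_in.
Qed.

Lemma rep_delta_sum x : \sum_p K p p x = x.
Proof.
rewrite -[RHS](rep_one rho_rep) rep_expand ?(subalg1 A_diag) //.
apply: eq_bigr => p _; rewrite (bigD1 p) //= mxE eqxx scale1r big1 ?addr0 //.
by move=> q qp; rewrite mxE eq_sym (negPf qp) scale0r.
Qed.

Lemma rep_delta_comp p q r x : delta_mx p q \in A -> delta_mx q r \in A ->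
  K p q (K q r x) = K p r x.
Proof. by move=> pq qr; rewrite -(rep_mul rho_rep) // mul_delta_mx. Qed.

Lemma rep_delta_contractive p q x : delta_mx p q \in A ->
  inner (K p q x) (K p q x) <= inner x x.
Proof. by move=> pq; apply: rep_le => //; exact: mx_opnorm_delta. Qed.

Lemma rep_involution_selfadjoint U x y : U \in A -> U *m U = 1%:M ->
  mx_opnorm U <= 1 -> inner (rho U x) y = inner x (rho U y).
Proof.
move=> AU UU U1; apply: contractive_involution_selfadjoint.
- exact: op_linear.
- by move=> z; apply: rep_le.
- by move=> z; rewrite -(rep_mul rho_rep) // UU (rep_one rho_rep).
Qed.

(** Contractive idempotents are self-adjoint; here the contractive involution is
    the image of the symmetry 1 - 2 E_pp. *)
Lemma rep_delta_diag_selfadjoint p x y : inner (K p p x) y = inner x (K p p y).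
Proof.
have Ap := subalg_delta_diag A_diag p.
have A1 := subalg1 A_diag.
pose U : 'M[C]_n := (-2) *: delta_mx p p + 1%:M.
have rhoU z : rho U z = (-2) *: K p p z + z.
  by rewrite (rep_linear rho_rep) // (rep_one rho_rep).
have : inner (rho U x) y = inner x (rho U y).
  apply: rep_involution_selfadjoint.
  - by rewrite subalgD ?subalgZ.
  - rewrite mulmxDl mulmxDr mulmx1 mul1mx -scalemxAl -scalemxAr mul_delta_mx.
    rewrite addrA !scalerA -!scalerDl [X in X *: _](_ : _ = 0).
      by rewrite scale0r add0r.
    by ring.
  - apply: mx_opnorm_le1 => z; apply: ler_sum => k _.
    have -> : (U *m z) k 0 = -2 * ((k == p)%:R * z p 0) + z k 0.
      by rewrite mulmxDl mul1mx -scalemxAl mxE mxE delta_mulmx.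
    have [->|_] := eqVneq k p; last by rewrite mul0r mulr0 add0r.
    rewrite mul1r (_ : -2 * z p 0 + z p 0 = - z p 0) ?normrN //.
    by generalize (z p 0) => t; ring.
rewrite !rhoU linearDl linearDr /= linearZl_LR linearZr_LR /=.
move/addIr; rewrite rmorphN /= conjC_nat; apply: mulfI.
by rewrite oppr_eq0 pnatr_eq0.
Qed.

(** The transposition matrix U of p and q lies in A, and E_pq = E_pp U E_qq. *)
Lemma rep_delta_adjoint p q x y : delta_mx p q \in A -> delta_mx q p \in A ->
  inner (K p q x) y = inner x (K q p y).
Proof.
move=> pq qp.
have Ap := subalg_delta_diag A_diag p.
have Aq := subalg_delta_diag A_diag q.
pose U : 'M[C]_n := tperm_mx p q.
have UE i j : U i j = (tperm p q i == j)%:R by rewrite /U /tperm_mx !mxE.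
have AU : U \in A.
  apply: (mem_subalg A_subalg) => i j.
  rewrite UE pnatr_eq0 eqb0 negbK => /eqP <-.
  by case: tpermP => [->|->|_ _] //; exact: subalg_delta_diag.
have UU : U *m U = 1%:M by rewrite -perm_mxM tperm2 perm_mx1.
have U1 : mx_opnorm U <= 1.
  apply: mx_opnorm_le1 => z; rewrite (reindex_inj (@perm_inj _ (tperm p q))) /=.
  apply: ler_sum => i _.
  by rewrite /U /tperm_mx -row_permE mxE tpermK.
have Kpq z : K p q z = K p p (rho U (K q q z)).
  rewrite -!(rep_mul rho_rep) ?subalgM // delta_mulmx_delta UE tpermL.
  by rewrite eqxx scale1r.
have Kqp z : K q p z = K q q (rho U (K p p z)).
  rewrite -!(rep_mul rho_rep) ?subalgM // delta_mulmx_delta UE tpermR.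
  by rewrite eqxx scale1r.
rewrite Kpq Kqp rep_delta_diag_selfadjoint rep_involution_selfadjoint //.
by rewrite rep_delta_diag_selfadjoint.
Qed.

End ContractiveRepresentations.

(** * Positive semidefinite forms *)

Section PositiveSemidefiniteMatrices.
Variables (C : numClosedFieldType).

(** Diagonalize G and take the square roots of its eigenvalues. *)
Lemma psd_factor N (G : 'M[C]_N) : G \is hermsymmx ->
  (forall z : 'rV[C]_N, 0 <= (z *m G *m z^t*) 0 0) ->
  exists L : 'M[C]_N, G = L^t* *m L.
Proof.
move=> G_herm G_pos.
pose P := spectralmx G; pose d := spectral_diag G.
have P_unit : P \is unitarymx by exact: spectral_unitarymx.
have GE : G = P^t* *m diag_mx d *m P.
  by rewrite -invmx_unitary //; exact/orthomx_spectralP/hermitian_normalmx.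
have d_ge0 i : 0 <= d 0 i.
  have := G_pos (row i P).
  rewrite {1}GE (_ : _ 0 0 = (P *m (P^t* *m diag_mx d *m P) *m P^t*) i i).
    have /unitarymxP PP := P_unit.
    by rewrite !mulmxA PP mul1mx -mulmxA PP mulmx1 mxE eqxx.
  rewrite -row_mul mxE [RHS]mxE; apply: eq_bigr => j _.
  by rewrite !mxE.
pose D : 'rV[C]_N := \row_i sqrtC (d 0 i).
exists (diag_mx D *m P).
rewrite trmx_mul map_mxM GE tr_diag_mx map_diag_mx !mulmxA.
congr (_ *m _); rewrite -mulmxA; congr (_ *m _).
rewrite mulmx_diag; congr diag_mx; apply/rowP => i; rewrite !mxE.
have /CrealP /= -> : sqrtC (d 0 i) \is Num.real.
  by rewrite ger0_real ?sqrtC_ge0.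
by rewrite -expr2 sqrtCK.
Qed.

End PositiveSemidefiniteMatrices.

Section PositiveForm.
Variables (C : numClosedFieldType) (V : lmodType C) (B : V -> V -> C).
Hypothesis B_linear : forall c u u' v, B (c *: u + u') v = c * B u v + B u' v.
Hypothesis B_herm : forall u v, B u v = (B v u)^*.
Hypothesis B_ge0 : forall u, 0 <= B u u.

Lemma form0l v : B 0 v = 0.
Proof. by have := B_linear (-1) 0 0 v; rewrite scaleN1r addNr mulN1r addNr. Qed.

Lemma form_suml (I : finType) (c : I -> C) (u : I -> V) v :
  B (\sum_i c i *: u i) v = \sum_i c i * B (u i) v.
Proof.
elim/big_rec2: _ => [|i x y _ IH]; first exact: form0l.
by rewrite B_linear IH.
Qed.

Lemma form_sumr (I : finType) (c : I -> C) (v : I -> V) u :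
  B u (\sum_i c i *: v i) = \sum_i (c i)^* * B u (v i).
Proof.
rewrite B_herm form_suml rmorph_sum; apply: eq_bigr => i _.
by rewrite rmorphM /= -B_herm.
Qed.

Lemma form_le_sum u v : B u v + B v u <= B u u + B v v.
Proof.
have subl x y z : B (x - y) z = B x z - B y z.
  by rewrite -scaleN1r addrC B_linear mulN1r addrC.
have subr x y z : B x (y - z) = B x y - B x z.
  by rewrite B_herm subl rmorphB /= -!B_herm.
have := B_ge0 (u - v); rewrite subl !subr.
move: (B u u) (B u v) (B v u) (B v v) => a b c d abcd.
by rewrite -subr_ge0 (_ : _ - _ = a - b - (c - d)) //; ring.
Qed.

(** The operator a (x) 1 on tuples of vectors of V is bounded as a is on tuples
    of scalars. The Gram matrix of the vectors v_j factors, so that these vectors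
    may be replaced by the columns of a matrix g of scalars with the same inner
    products; the hypothesis is then applied to each row of g. *)
Lemma form_ampliation (I J : finType) (a : I -> J -> C) (m : C) (v : J -> V) :
  (forall z : J -> C,
     \sum_i `|\sum_j a i j * z j| ^+ 2 <= m * \sum_j `|z j| ^+ 2) ->
  \sum_i B (\sum_j a i j *: v j) (\sum_j a i j *: v j)
    <= m * \sum_j B (v j) (v j).
Proof.
move=> a_le.
pose G : 'M[C]_#|J| := \matrix_(s, t) B (v (enum_val t)) (v (enum_val s)).
have [||L GL] := @psd_factor _ _ G.
- apply/is_hermitianmxP; rewrite expr0 scale1r.
  by apply/matrixP => s t; rewrite !mxE B_herm.
- move=> z; have := B_ge0 (\sum_s (z 0 s)^* *: v (enum_val s)).
  rewrite form_suml; congr (0 <= _); rewrite mxE; apply: eq_bigr => t _.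
  rewrite !mxE mulrC form_sumr; congr (_ * _); apply: eq_bigr => s _.
  by rewrite !mxE conjCK.
pose g r j := L r (enum_rank j).
have Bg j l : B (v j) (v l) = \sum_r g r j * (g r l)^*.
  have := congr1 (fun M : 'M[C]_#|J| => M (enum_rank l) (enum_rank j)) GL.
  rewrite !mxE !enum_rankK => ->; apply: eq_bigr => r _.
  by rewrite !mxE mulrC.
have -> : \sum_i B (\sum_j a i j *: v j) (\sum_j a i j *: v j) =
    \sum_r \sum_i `|\sum_j a i j * g r j| ^+ 2.
  rewrite exchange_big; apply: eq_bigr => i _ /=.
  rewrite form_suml.
  transitivity
      (\sum_j \sum_r \sum_l a i j * ((a i l)^* * (g r j * (g r l)^*))).
    apply: eq_bigr => j _; rewrite form_sumr mulr_sumr exchange_big /=.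
    by apply: eq_bigr => l _; rewrite Bg !mulr_sumr.
  rewrite exchange_big; apply: eq_bigr => r _ /=.
  rewrite normCK rmorph_sum mulr_suml; apply: eq_bigr => j _.
  rewrite !mulr_sumr; apply: eq_bigr => l _.
  by rewrite rmorphM /= [LHS]mulrA mulrACA.
have -> : \sum_j B (v j) (v j) = \sum_r \sum_j `|g r j| ^+ 2.
  rewrite exchange_big; apply: eq_bigr => j _; rewrite Bg.
  by apply: eq_bigr => r _; rewrite normCK.
by rewrite mulr_sumr; apply: ler_sum => r _; apply: a_le.
Qed.

End PositiveForm.

(** * The positive extension of a contractive representation *)

Section PositiveExtension.
Variables (R : realType) (n : nat) (A : {pred 'M[R[i]]_n}).
Local Notation C := R[i].
Hypothesis A_subalg : is_subalgebra A.
Hypothesis A_diag : forall d : 'M[C]_n, is_diag_mx d -> d \in A.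
Hypothesis A_total : forall p q, (delta_mx p q \in A) || (delta_mx q p \in A).
Variables (H : hilbertType R) (rho : 'M[C]_n -> bounded_op H).
Hypothesis rho_rep : contractive_rep A rho.

Local Notation K p q := (rho (delta_mx p q)).
Local Notation "p '<=A' q" := (delta_mx p q \in A) (at level 70).

(** The sesquilinear form of the entry (p, q) of the completed operator matrix:
    that of K_pq, or else that of the adjoint of K_qp. *)
Definition rep_kernel p q (x y : H) : C :=
  if p <=A q then inner (K p q x) y else inner x (K q p y).

Lemma rep_kernelE p q x y : p <=A q -> rep_kernel p q x y = inner (K p q x) y.
Proof. by rewrite /rep_kernel => ->. Qed.

Lemma rep_kernelC p q x y : rep_kernel q p y x = (rep_kernel p q x y)^*.
Proof.
rewrite /rep_kernel; have := A_total p q.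
case: ifPn => [qp|_]; case: ifPn => [pq|_] // _; rewrite -innerC //.
exact: (rep_delta_adjoint A_subalg A_diag rho_rep).
Qed.

Lemma rep_kernel_linear p q c x x' y :
  rep_kernel p q (c *: x + x') y
    = c * rep_kernel p q x y + rep_kernel p q x' y.
Proof.
rewrite /rep_kernel; case: ifP => _; rewrite ?op_linear linearDl /=.
  by rewrite linearZl_LR.
by rewrite linearZl_LR.
Qed.

(** The left-hand side strengthens the positivity of the completed matrix into a
    bound that can be proved by induction on a sorted list h :: s of indices.
    With t = sum_(q in s) K_hq u_q, the quadratic form of h :: s is
    |K_hh u_h|^2 + 2 Re <t, K_hh u_h> plus that of s, which is at least |t|^2 by
    induction. So it is at least |K_hh u_h + t|^2, which does not increase when
    the contraction K_ph is applied. *)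
Lemma rep_kernel_sorted_ge p (s : seq 'I_n) (u : 'I_n -> H) :
  path (fun p q => p <=A q) p s ->
  inner (\sum_(q <- s) K p q (u q)) (\sum_(q <- s) K p q (u q))
    <= \sum_(r <- s) \sum_(q <- s) rep_kernel r q (u q) (u r).
Proof.
elim: s p => [|h s IH] p; first by rewrite !big_nil linear0l.
move=> /andP [ph hs].
have Ah := subalg_delta_diag A_diag h.
have h_le q : q \in s -> h <=A q.
  have tr : transitive (fun p q : 'I_n => p <=A q).
    by move=> q' p' r; exact: delta_mx_in_trans.
  by move: (order_path_min tr hs) => /allP; apply.
set t := \sum_(q <- s) K h q (u q).
have KD r x y : K r h (x + y) = K r h x + K r h y.
  by have := op_linear (K r h) 1 x y; rewrite !scale1r.
have K0 r : K r h 0 = 0 by apply: (addrI (K r h 0)); rewrite -KD !addr0.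
have Kt r : r <=A h -> K r h t = \sum_(q <- s) K r q (u q).
  move=> rh; rewrite /t (big_morph _ (KD r) (K0 r)).
  by apply: eq_big_seq => q /h_le hq; rewrite (rep_delta_comp rho_rep).
have -> : \sum_(q <- h :: s) K p q (u q) = K p h (K h h (u h) + t).
  by rewrite KD big_cons (rep_delta_comp rho_rep) // Kt.
apply: le_trans (rep_delta_contractive rho_rep _ ph) _.
rewrite linearDl !linearDr /=.
have sumE : \sum_(q <- s) rep_kernel h q (u q) (u h) = inner t (K h h (u h)).
  rewrite -(rep_delta_diag_selfadjoint A_subalg A_diag rho_rep) Kt //.
  rewrite linear_sumlz; apply: eq_big_seq => q /h_le; exact: rep_kernelE.
have sumE' : \sum_(r <- s) rep_kernel r h (u h) (u r) = inner (K h h (u h)) t.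
  rewrite innerC -sumE rmorph_sum; apply: eq_bigr => r _.
  exact: rep_kernelC.
have hhE : rep_kernel h h (u h) (u h) = inner (K h h (u h)) (K h h (u h)).
  rewrite rep_kernelE //.
  rewrite -[in RHS](rep_delta_diag_selfadjoint A_subalg A_diag rho_rep).
  by rewrite (rep_delta_comp rho_rep).
rewrite big_cons big_cons hhE sumE -!addrA lerD2l.
under [X in _ <= _ + X]eq_bigr => r _ do rewrite big_cons.
rewrite big_split /= sumE' addrCA lerD2l lerD2l.
exact: IH.
Qed.

Definition rep_form (u v : {ffun 'I_n -> H}) : C :=
  \sum_p \sum_q rep_kernel p q (u q) (v p).

Lemma rep_form_linear c u u' v :
  rep_form (c *: u + u') v = c * rep_form u v + rep_form u' v.
Proof.
rewrite /rep_form mulr_sumr -big_split; apply: eq_bigr => p _ /=.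
rewrite mulr_sumr -big_split; apply: eq_bigr => q _ /=.
by rewrite !ffunE rep_kernel_linear.
Qed.

Lemma rep_form_herm u v : rep_form u v = (rep_form v u)^*.
Proof.
rewrite /rep_form exchange_big rmorph_sum; apply: eq_bigr => p _ /=.
rewrite rmorph_sum; apply: eq_bigr => q _; exact: rep_kernelC.
Qed.

Lemma rep_form_ge0 u : 0 <= rep_form u u.
Proof.
pose leA := fun p q : 'I_n => p <=A q.
pose s := sort leA (index_enum 'I_n).
have -> : rep_form u u =
    \sum_(r <- s) \sum_(q <- s) rep_kernel r q (u q) (u r).
  have s_perm : perm_eq (index_enum 'I_n) s by rewrite perm_sym perm_sort.
  rewrite /rep_form (perm_big _ s_perm); apply: eq_bigr => p _.
  exact: perm_big.
have : sorted leA s by exact: sort_sorted.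
case: s => [|p s] ps; first by rewrite big_nil.
apply: le_trans (rep_kernel_sorted_ge (p := p) u _); last first.
  by rewrite /= (subalg_delta_diag A_diag).
exact: inner_ge0.
Qed.

Definition at_coord (q : 'I_n) (x : H) : {ffun 'I_n -> H} :=
  [ffun r => if r == q then x else 0].

Lemma rep_form_at_coord p q x y :
  rep_form (at_coord q x) (at_coord p y) = rep_kernel p q x y.
Proof.
have k0l r t z : rep_kernel r t 0 z = 0.
  by have := rep_kernel_linear r t (-1) 0 0 z;
     rewrite scaleN1r addNr mulN1r addNr.
have k0r r t z : rep_kernel r t z 0 = 0 by rewrite rep_kernelC k0l conjC0.
rewrite /rep_form (bigD1 p) //= (bigD1 q) //= !ffunE !eqxx.
rewrite !big1 ?addr0 // => [r rp|t tq].
  by apply: big1 => t _; rewrite [at_coord p y r]ffunE (negPf rp) k0r.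
by rewrite ffunE (negPf tq) k0l.
Qed.

(** Let y be the image of x under the block operator of rho at a. With v_(j, q)
    the vector x_j placed at the coordinate q of H^n, f the tuple obtained from
    v by the scalar matrix a, and g obtained from y as v is from x, one has
    |y|^2 = sum B(f, g) for the form B of the completed matrix, as well as
    |x|^2 = sum B(v, v) and |y|^2 = sum B(g, g). The inequality
    2 Re B(f, g) <= B(f, f) + B(g, g) then gives |y|^2 <= sum B(f, f), which
    [form_ampliation] bounds by |a|^2 |x|^2. *)
Lemma rep_completely_contractive : completely_contractive A rho.
Proof.
move=> k a Aa.
pose m := block_mx_opnorm a.
have m_ge0 : 0 <= m by apply: opnorm_ge0 => z; exact: l2norm_ge0.
apply: opnorm_le => [c x c0|x x1].
  by apply: l2normZ => // y; exact: hnormZ.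
suff xy : l2norm (@hnorm R H) (block_op (fun i j => rho (a i j)) x)
    <= m * l2norm (@hnorm R H) x.
  by apply: le_trans xy _; exact: ler_piMr.
rewrite ler_mul_sqC ?l2norm_ge0 // !l2norm_sq.
under eq_bigr do rewrite hnorm_sq.
under [X in _ <= _ * X]eq_bigr do rewrite hnorm_sq.
set y := block_op _ x; set S := \sum_i _.
pose b (s t : 'I_k * 'I_n) := a s.1 t.1 s.2 t.2.
pose v (t : 'I_k * 'I_n) := at_coord t.2 (x t.1).
pose f s := \sum_t b s t *: v t.
pose g (s : 'I_k * 'I_n) := at_coord s.2 (y s.1).
have sum_at (z : {ffun 'I_k -> H}) :
    \sum_(s : 'I_k * 'I_n)
      rep_form (at_coord s.2 (z s.1)) (at_coord s.2 (z s.1))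
    = \sum_i inner (z i) (z i).
  rewrite -(pair_big predT predT
    (fun i p => rep_form (at_coord p (z i)) (at_coord p (z i)))) /=.
  apply: eq_bigr => i _.
  rewrite -[X in inner X _](rep_delta_sum A_subalg A_diag rho_rep) linear_sumlz.
  apply: eq_bigr => p _.
  by rewrite rep_form_at_coord rep_kernelE ?(subalg_delta_diag A_diag).
have fg : \sum_s rep_form (f s) (g s) = S.
  rewrite -(pair_big predT predT
    (fun i p => rep_form (f (i, p)) (g (i, p)))) /=.
  apply: eq_bigr => i _.
  transitivity (\sum_p \sum_j \sum_q
      a i j p q * inner (K p q (x j)) (y i)).
    apply: eq_bigr => p _; rewrite (form_suml rep_form_linear) pair_big /=.
    apply: eq_bigr => -[j q] _; rewrite /b /v /g /= rep_form_at_coord.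
    have [->|apq] := eqVneq (a i j p q) 0; first by rewrite !mul0r.
    by rewrite rep_kernelE // (delta_mx_in A_subalg A_diag (Aa i j)).
  rewrite [X in inner X _]ffunE linear_sumlz exchange_big.
  apply: eq_bigr => j _; rewrite (rep_expand A_subalg A_diag rho_rep) //.
  rewrite linear_sumlz.
  apply: eq_bigr => p _ /=; rewrite linear_sumlz; apply: eq_bigr => q _ /=.
  by rewrite linearZl_LR.
have S_real : S^* = S.
  by apply/CrealP/ger0_real/sumr_ge0 => i _; exact: inner_ge0.
have gf : \sum_s rep_form (g s) (f s) = S.
  rewrite -S_real -fg rmorph_sum; apply: eq_bigr => s _; exact: rep_form_herm.
have Sf : S <= \sum_s rep_form (f s) (f s).
  have : \sum_s (rep_form (f s) (g s) + rep_form (g s) (f s))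
      <= \sum_s (rep_form (f s) (f s) + rep_form (g s) (g s)).
    apply: ler_sum => s _.
    exact: (form_le_sum rep_form_linear rep_form_herm rep_form_ge0).
  by rewrite !big_split /= fg gf sum_at lerD2r.
apply: le_trans Sf _; rewrite -(sum_at x).
apply: (form_ampliation rep_form_linear rep_form_herm rep_form_ge0) => z.
have := le_block_mx_opnorm a (fun j q => z (j, q)).
rewrite !pair_big /=.
have -> : \sum_(p : 'I_k * 'I_n) `|z (p.1, p.2)| ^+ 2 = \sum_j `|z j| ^+ 2.
  by apply: eq_bigr => -[].
apply: le_trans; rewrite le_eqVlt; apply/orP/or_introl/eqP.
apply: eq_bigr => -[i p] _ /=; rewrite pair_big /=.
by congr (`|_| ^+ 2); apply: eq_bigr => -[].
Qed.

End PositiveExtension.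

Theorem corollary2p3 (R : realType) (n : nat) (n_ge1 : (1 <= n)%N)
    (A : {pred 'M[R[i]]_n})
    (A_subalg : is_subalgebra A)
    (A_diag : forall d : 'M[R[i]]_n, is_diag_mx d -> d \in A)
    (A_logmodular : logmodular A)
    (H : hilbertType R) (rho : 'M[R[i]]_n -> bounded_op H)
    (rho_rep : contractive_rep A rho) :
  completely_contractive A rho.
Proof.
apply: rep_completely_contractive => //.
exact: logmodular_total.
Qed.
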